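(* The pseudo $H$-type Lie algebras $\mathfrak n_{3,2}$ and $\mathfrak n_{2,3}$ are not isomorphic (as Lie algebras).
   Context: For integers $r,s\ge 0$ with $r+s\ge1$, $\mathbb R^{r,s}$ is $\mathbb R^{r+s}$ with $\langle Z,W\rangle_{r,s}=\sum_{i=1}^r Z_iW_i-\sum_{j=r+1}^{r+s}Z_jW_j$, and $\mathrm{Cl}_{r,s}$ is the real unital associative algebra generated by $\mathbb R^{r,s}$ subject to $Z\otimes Z=-\langle Z,Z\rangle_{r,s}\,1$. A scalar product is a non-degenerate (possibly indefinite) symmetric bilinear form. An admissible $\mathrm{Cl}_{r,s}$-module is a non-zero finite-dimensional real vector space $\mathfrak v$ with a representation $J:\mathrm{Cl}_{r,s}\to\mathrm{End}(\mathfrak v)$ and a scalar product $\langle\cdot,\cdot\rangle_{\mathfrak v}$ such that $\langle J_Zv,w\rangle_{\mathfrak v}=-\langle v,J_Zw\rangle_{\mathfrak v}$ for all $Z\in\mathbb R^{r,s}$, $v,w\in\mathfrak v$. It is minimal if its dimension is minimal among admissible $\mathrm{Cl}_{r,s}$-modules. The associated pseudo $H$-type Lie algebra is $\mathfrak n=\mathfrak v\oplus\mathbb R^{r,s}$ (orthogonal sum), with center $\mathbb R^{r,s}$ and bracket $[\cdot,\cdot]:\mathfrak v\times\mathfrak v\to\mathbb R^{r,s}$ determined by $\langle J_Zv,w\rangle_{\mathfrak v}=\langle Z,[v,w]\rangle_{r,s}$ for all $Z\in\mathbb R^{r,s}$, $v,w\in\mathfrak v$. The notation $\mathfrak n_{r,s}=\mathfrak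 v_{r,s}\oplus\mathfrak z_{r,s}$, $\mathfrak z_{r,s}=\mathbb R^{r,s}$, stands for the pseudo $H$-type Lie algebra built from a minimal admissible module $\mathfrak v_{r,s}$. Isomorphisms are isomorphisms of Lie algebras, with no condition on scalar products. *)

(* Defs.v *)
From HB Require Import structures.
From mathcomp Require Import all_boot all_order all_algebra.
From mathcomp Require Import boolp reals.
From mathcomp Require Import ring.

Set Implicit Arguments.
Unset Strict Implicit.
Unset Printing Implicit Defensive.

Import Order.TTheory GRing.Theory Num.Theory.
Local Open Scope ring_scope.

Section PseudoEuclidean.
Variables (R : realType) (r s : nat).
Implicit Types Z W : 'rV[R]_(r + s).

Definition pform Z W : R :=
  \sum_(i < r) Z 0 (lshift s i) * W 0 (lshift s i)
  - \sum_(j < s) Z 0 (rshift r j) * W 0 (rshift r j).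

Definition psign (i : 'I_(r + s)) : R := if (i < r)%N then 1 else -1.

Lemma psign_lshift i : psign (lshift s i) = 1.
Proof. by rewrite /psign /= ltn_ord. Qed.

Lemma psign_rshift j : psign (rshift r j) = -1.
Proof. by rewrite /psign /= ltnNge leq_addr. Qed.

Lemma psignK i : psign i * psign i = 1.
Proof. by rewrite /psign; case: ifP; rewrite ?mulr1 ?mulrNN ?mulr1. Qed.

Lemma pformE Z W : pform Z W = \sum_i psign i * (Z 0 i * W 0 i).
Proof.
rewrite big_split_ord /= /pform -sumrN; congr (_ + _); apply: eq_bigr => i _.
  by rewrite psign_lshift mul1r.
by rewrite psign_rshift mulN1r.
Qed.

End PseudoEuclidean.

(* Cl_{r,s} is literally the presented algebra: formal expressions in the      *)
(* vectors of R^{r,s} and the real scalars, modulo the least congruence        *)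
(* containing the axioms of a real unital associative algebra, the linearity   *)
(* of the inclusion of R^{r,s}, and Z^2 = - <Z, Z> 1.                          *)
Inductive clterm (R : realType) (r s : nat) : Type :=
| ClVec of 'rV[R]_(r + s)
| ClScal of R
| ClAdd of clterm R r s & clterm R r s
| ClMul of clterm R r s & clterm R r s.
Arguments ClScal {R r s}.
Arguments ClVec {R r s}.

HB.instance Definition _ (R : realType) (r s : nat) := gen_eqMixin (clterm R r s).
HB.instance Definition _ (R : realType) (r s : nat) :=
  gen_choiceMixin (clterm R r s).

Inductive cleq (R : realType) (r s : nat) : clterm R r s -> clterm R r s -> Prop :=
| cleq_refl x : cleq x x
| cleq_sym x y : cleq x y -> cleq y x
| cleq_trans x y z : cleq x y -> cleq y z -> cleq x z
| cleq_add x x' y y' : cleq x x' -> cleq y y' -> cleq (ClAdd x y) (ClAdd x' y')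
| cleq_mul x x' y y' : cleq x x' -> cleq y y' -> cleq (ClMul x y) (ClMul x' y')
| cleq_addA x y z : cleq (ClAdd x (ClAdd y z)) (ClAdd (ClAdd x y) z)
| cleq_addC x y : cleq (ClAdd x y) (ClAdd y x)
| cleq_add0 x : cleq (ClAdd (ClScal 0) x) x
| cleq_addN x : cleq (ClAdd (ClMul (ClScal (-1)) x) x) (ClScal 0)
| cleq_mulA x y z : cleq (ClMul x (ClMul y z)) (ClMul (ClMul x y) z)
| cleq_mul1 x : cleq (ClMul (ClScal 1) x) x
| cleq_mulDl x y z : cleq (ClMul (ClAdd x y) z) (ClAdd (ClMul x z) (ClMul y z))
| cleq_mulDr x y z : cleq (ClMul x (ClAdd y z)) (ClAdd (ClMul x y) (ClMul x z))
| cleq_scalD a b : cleq (ClScal (a + b)) (ClAdd (ClScal a) (ClScal b))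
| cleq_scalM a b : cleq (ClScal (a * b)) (ClMul (ClScal a) (ClScal b))
| cleq_scalC a x : cleq (ClMul (ClScal a) x) (ClMul x (ClScal a))
| cleq_vecD Z W : cleq (ClVec (Z + W)) (ClAdd (ClVec Z) (ClVec W))
| cleq_vecZ a Z : cleq (ClVec (a *: Z)) (ClMul (ClScal a) (ClVec Z))
| cleq_clifford Z : cleq (ClMul (ClVec Z) (ClVec Z)) (ClScal (- pform Z Z)).

Section CliffordAlgebra.
Variables (R : realType) (r s : nat).
Local Notation T := (clterm R r s).
Local Notation V := 'rV[R]_(r + s).

Definition clrel (x y : T) : bool := `[< cleq x y >].

Lemma clrel_refl : reflexive clrel.
Proof. by move=> x; apply/asboolP/cleq_refl. Qed.

Lemma clrel_sym : symmetric clrel.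
Proof. by move=> x y; apply/asboolP/asboolP; apply: cleq_sym. Qed.

Lemma clrel_trans : transitive clrel.
Proof.
by move=> y x z /asboolP xy /asboolP yz; apply/asboolP; apply: cleq_trans yz.
Qed.

Canonical clrel_equiv := EquivRel clrel clrel_refl clrel_sym clrel_trans.

Definition clifford := {eq_quot clrel}%qT.
HB.instance Definition _ := Choice.on clifford.

Definition clclass (x : T) : clifford := (\pi_({eq_quot clrel}) x)%qT.

Lemma clclassP x y : clclass x = clclass y <-> cleq x y.
Proof.
split=> [/eqP|xy]; first by rewrite eqmodE => /asboolP.
by apply/eqP; rewrite eqmodE; apply/asboolP.
Qed.

Lemma clclass_surj (u : clifford) : exists x, u = clclass x.
Proof. by exists (repr u); rewrite /clclass reprK. Qed.

Definition clrepr (u : clifford) : T := repr u.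

Lemma clreprK u : clclass (clrepr u) = u. Proof. exact: reprK. Qed.

Lemma cleq_repr x : cleq (clrepr (clclass x)) x.
Proof. by apply/clclassP; rewrite clreprK. Qed.

Definition clscal (a : R) : clifford := clclass (ClScal a).
Definition cladd (u v : clifford) : clifford :=
  clclass (ClAdd (clrepr u) (clrepr v)).
Definition clmul (u v : clifford) : clifford :=
  clclass (ClMul (clrepr u) (clrepr v)).
Definition clopp (u : clifford) : clifford := clmul (clscal (-1)) u.
Definition clscale (a : R) (u : clifford) : clifford := clmul (clscal a) u.

Lemma claddE x y : cladd (clclass x) (clclass y) = clclass (ClAdd x y).
Proof. by apply/clclassP/cleq_add; apply: cleq_repr. Qed.

Lemma clmulE x y : clmul (clclass x) (clclass y) = clclass (ClMul x y).
Proof. by apply/clclassP/cleq_mul; apply: cleq_repr. Qed.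

Let clE := (claddE, clmulE).

Lemma claddA : associative cladd.
Proof.
move=> u v w; case: (clclass_surj u) (clclass_surj v) (clclass_surj w).
by move=> x -> [y ->] [z ->]; rewrite !clE; apply/clclassP/cleq_addA.
Qed.

Lemma claddC : commutative cladd.
Proof.
move=> u v; case: (clclass_surj u) (clclass_surj v) => x -> [y ->].
by rewrite !clE; apply/clclassP/cleq_addC.
Qed.

Lemma cladd0 : left_id (clscal 0) cladd.
Proof.
move=> u; case: (clclass_surj u) => x ->.
by rewrite !clE; apply/clclassP/cleq_add0.
Qed.

Lemma claddN : left_inverse (clscal 0) clopp cladd.
Proof.
move=> u; case: (clclass_surj u) => x ->.
by rewrite /clopp clmulE claddE; apply/clclassP/cleq_addN.
Qed.

HB.instance Definition _ :=
  GRing.isZmodule.Build clifford claddA claddC cladd0 claddN.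

Lemma clmulA : associative clmul.
Proof.
move=> u v w; case: (clclass_surj u) (clclass_surj v) (clclass_surj w).
by move=> x -> [y ->] [z ->]; rewrite !clE; apply/clclassP/cleq_mulA.
Qed.

Lemma clscalC a u : clmul (clscal a) u = clmul u (clscal a).
Proof.
case: (clclass_surj u) => x ->.
by rewrite !clE; apply/clclassP/cleq_scalC.
Qed.

Lemma clmul1 : left_id (clscal 1) clmul.
Proof.
move=> u; case: (clclass_surj u) => x ->.
by rewrite !clE; apply/clclassP/cleq_mul1.
Qed.

Lemma clmulr1 : right_id (clscal 1) clmul.
Proof. by move=> u; rewrite -clscalC clmul1. Qed.

Lemma clmulDl : left_distributive clmul cladd.
Proof.
move=> u v w; case: (clclass_surj u) (clclass_surj v) (clclass_surj w).
by move=> x -> [y ->] [z ->]; rewrite !clE; apply/clclassP/cleq_mulDl.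
Qed.

Lemma clmulDr : right_distributive clmul cladd.
Proof.
move=> u v w; case: (clclass_surj u) (clclass_surj v) (clclass_surj w).
by move=> x -> [y ->] [z ->]; rewrite !clE; apply/clclassP/cleq_mulDr.
Qed.

Lemma clscalM a b : clscal (a * b) = clmul (clscal a) (clscal b).
Proof. by rewrite clmulE; apply/clclassP/cleq_scalM. Qed.

Lemma clscalD a b : clscal (a + b) = cladd (clscal a) (clscal b).
Proof. by rewrite claddE; apply/clclassP/cleq_scalD. Qed.

Section Evaluation.
Variables (A : algType R) (f : V -> A).

Fixpoint cleval (x : T) : A :=
  match x with
  | ClVec Z => f Z
  | ClScal a => a%:A
  | ClAdd x y => cleval x + cleval y
  | ClMul x y => cleval x * cleval y
  end.

Hypotheses (fD : {morph f : Z W / Z + W}) (fZ : scalable f).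
Hypothesis (fsqr : forall Z, f Z * f Z = - pform Z Z *: 1).

Lemma cleval_eq x y : cleq x y -> cleval x = cleval y.
Proof.
elim=> {x y} //=.
- by move=> x y z _ -> _ ->.
- by move=> x x' y y' _ -> _ ->.
- by move=> x x' y y' _ -> _ ->.
- by move=> *; rewrite addrA.
- by move=> *; rewrite addrC.
- by move=> *; rewrite scale0r add0r.
- by move=> *; rewrite scaleN1r mulN1r addNr scale0r.
- by move=> *; rewrite mulrA.
- by move=> *; rewrite scale1r mul1r.
- by move=> *; rewrite mulrDl.
- by move=> *; rewrite mulrDr.
- by move=> *; rewrite scalerDl.
- by move=> *; rewrite -scalerAl mul1r scalerA.
- by move=> *; rewrite -scalerAl -scalerAr mul1r mulr1.
- by move=> *; rewrite fZ -scalerAl mul1r.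
Qed.

End Evaluation.

(* Generalized Pauli matrices, showing that the presentation above does not    *)
(* collapse.                                                                   *)
Lemma anticommuting_family (q : nat -> R) (n : nat) :
  exists d (J : nat -> 'M[R]_d.+1),
    (forall i, (i < n)%N -> J i * J i = q i *: 1)
    /\ (forall i j, (i < n)%N -> (j < n)%N -> i != j ->
          J i * J j + J j * J i = 0).
Proof.
elim: n => [|n [d [J [Jsq Jac]]]]; first by exists 0%N, (fun=> 0); split.
pose D i : 'M[R]_(d.+1 + d.+1) := block_mx (J i) 0 0 (- J i).
pose N : 'M[R]_(d.+1 + d.+1) := block_mx 0 (q n *: 1) 1 0.
exists (d + d.+1)%N, (fun i => if (i < n)%N then D i else N).
have DD i j : D i *m D j = block_mx (J i * J j) 0 0 (J i * J j).
  rewrite /D mulmx_block !(mulmx0, mul0mx, addr0, add0r).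
  by rewrite mulNmx mulmxN opprK.
have E (i : nat) : (i < n.+1)%N -> (i < n)%N = false -> i = n.
  by rewrite ltnS leq_eqVlt => /orP[/eqP //|->].
have DN i : D i *m N + N *m D i = 0.
  rewrite /D /N !mulmx_block !(mulmx0, mul0mx, addr0, add0r) add_block_mx.
  rewrite !addr0 -!scalemxAl -!scalemxAr !mulNmx !mulmxN !mulmx1 !mul1mx.
  by rewrite scalerN subrr addNr block_mx0.
have one : (1 : 'M[R]_((d + d.+1).+1)) = block_mx 1 0 0 1 :> 'M_(d.+1 + d.+1).
  by rewrite -[LHS]/(1%:M : 'M_(d.+1 + d.+1)) scalar_mx_block.
split=> [i|i j] i_n.
  case: ifP => [lt_i_n|/(E _ i_n) ->].
    rewrite [LHS]DD Jsq //.
    by rewrite one (scale_block_mx _ 1 0 0 1 : _ *: (_ : 'M_(d.+1 + d.+1)) = _) !scaler0.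
  rewrite -[LHS]/(N *m N) mulmx_block !(mulmx0, mul0mx, addr0, add0r).
  rewrite mulmx1 mul1mx.
  by rewrite one (scale_block_mx _ 1 0 0 1 : _ *: (_ : 'M_(d.+1 + d.+1)) = _) !scaler0.
move=> j_n neq_ij; case: ifP => [lt_i_n|/(E _ i_n) ei]; last first.
  case: ifP => [_|/(E _ j_n) ej]; first by rewrite addrC; apply: DN.
  by rewrite ei ej eqxx in neq_ij.
case: ifP => [lt_j_n|_]; last exact: DN.
rewrite -[LHS]/(D i *m D j + D j *m D i) !DD add_block_mx !addr0.
by rewrite Jac // block_mx0.
Qed.

Lemma clifford_matrices : exists d (f : V -> 'M[R]_d.+1),
  [/\ {morph f : Z W / Z + W}, scalable f &
      forall Z, f Z * f Z = - pform Z Z *: 1].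
Proof.
pose q k : R := if (k < r)%N then -1 else 1.
have [d [J [Jsq Jac]]] := anticommuting_family q (r + s).
exists d, (fun Z : V => \sum_(i < r + s) Z 0 i *: J i); split.
- move=> Z W /=; rewrite -big_split; apply: eq_bigr => i _.
  by rewrite mxE scalerDl.
- move=> a Z /=; rewrite scaler_sumr; apply: eq_bigr => i _.
  by rewrite mxE scalerA.
move=> Z; set S := LHS.
have S1 : S = \sum_(i < r + s) \sum_(j < r + s) (Z 0 i * Z 0 j) *: (J i * J j).
  rewrite /S mulr_suml; apply: eq_bigr => i _; rewrite mulr_sumr.
  by apply: eq_bigr => j _; rewrite -scalerAl -scalerAr scalerA.
have S2 : S = \sum_(i < r + s) \sum_(j < r + s) (Z 0 i * Z 0 j) *: (J j * J i).
  rewrite S1 exchange_big; apply: eq_bigr => i _; apply: eq_bigr => j _.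
  by rewrite mulrC.
have S3 : S + S = \sum_(i < r + s) ((Z 0 i * Z 0 i * q i) *: 1 *+ 2).
  rewrite {1}S1 S2 -big_split; apply: eq_bigr => i _ /=.
  rewrite -big_split /= (bigD1 i) //= big1 ?addr0 => [|j neq_ji].
    by rewrite Jsq // scalerA -mulr2n.
  by rewrite -scalerDr Jac ?scaler0 // eq_sym.
apply: (@scalerI _ _ (2 : R)); first by rewrite pnatr_eq0.
rewrite !scaler_nat [LHS]mulr2n S3 pformE -sumrN scaler_suml -sumrMnl.
apply: eq_bigr => i _; congr (_ *: _ *+ 2).
by rewrite /q /psign; case: ifP => _; ring.
Qed.

Lemma clone_neq0 : clscal 1 != 0 :> clifford.
Proof.
have [d [f [fD fZ fsqr]]] := clifford_matrices.
apply/eqP => /clclassP /(cleval_eq fD fZ fsqr) /= /eqP.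
by rewrite scale1r scale0r oner_eq0.
Qed.

HB.instance Definition _ := GRing.Zmodule_isNzRing.Build clifford
  clmulA clmul1 clmulr1 clmulDl clmulDr clone_neq0.

Lemma clscaleA a b u : clscale a (clscale b u) = clscale (a * b) u.
Proof. by rewrite /clscale clscalM clmulA. Qed.

Lemma clscale1 : left_id 1 clscale. Proof. exact: clmul1. Qed.

Lemma clscaleDr : right_distributive clscale +%R.
Proof. by move=> a u v; rewrite /clscale; apply: clmulDr. Qed.

Lemma clscaleDl u : {morph clscale^~ u : a b / a + b}.
Proof. by move=> a b; rewrite /clscale clscalD; apply: clmulDl. Qed.

HB.instance Definition _ := GRing.Zmodule_isLmodule.Build R clifford
  clscaleA clscale1 clscaleDr clscaleDl.

Lemma clscaleAl a (u v : clifford) : a *: (u * v) = (a *: u) * v.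
Proof. exact: clmulA. Qed.

HB.instance Definition _ :=
  GRing.Lmodule_isLalgebra.Build R clifford clscaleAl.

Lemma clscaleAr a (u v : clifford) : a *: (u * v) = u * (a *: v).
Proof.
rewrite -[LHS]/(clmul (clscal a) (clmul u v)).
by rewrite -[RHS]/(clmul u (clmul (clscal a) v)) clmulA clscalC -clmulA clscalC.
Qed.

HB.instance Definition _ :=
  GRing.Lalgebra_isAlgebra.Build R clifford clscaleAr.

Definition clvec (Z : V) : clifford := clclass (ClVec Z).

Lemma clvec_is_linear : linear clvec.
Proof.
move=> a Z W; rewrite -[RHS]/(cladd (clmul (clscal a) (clvec Z)) (clvec W)).
rewrite clmulE claddE; apply/clclassP; apply: cleq_trans (cleq_vecD _ _) _.
by apply: cleq_add; [apply: cleq_vecZ | apply: cleq_refl].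
Qed.

HB.instance Definition _ :=
  GRing.isLinear.Build R V clifford *:%R clvec clvec_is_linear.

Lemma clscalE a : clscal a = a%:A.
Proof. by rewrite -[RHS]/(clmul (clscal a) (clscal 1)) clmulr1. Qed.

Lemma clvec_sqr Z : clvec Z * clvec Z = - pform Z Z *: 1.
Proof.
by rewrite -clscalE -[LHS]/(clmul _ _) clmulE; apply/clclassP/cleq_clifford.
Qed.

Lemma clifford_universal (A : algType R) (f : {linear V -> A}) :
  (forall Z, f Z * f Z = - pform Z Z *: 1) ->
  exists2 g : {lrmorphism clifford -> A}, (forall Z, g (clvec Z) = f Z) &
    forall h : {lrmorphism clifford -> A},
      (forall Z, h (clvec Z) = f Z) -> h =1 g.
Proof.
move=> fsqr; pose g (u : clifford) : A := cleval f (clrepr u).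
have gE x : g (clclass x) = cleval f x.
  by apply: (cleval_eq (raddfD f) (linearZ_LR f) fsqr); apply: cleq_repr.
have gZD a u v : g (a *: u + v) = a *: g u + g v.
  case: (clclass_surj u) (clclass_surj v) => x -> [y ->].
  rewrite -[a *: _ + _]/(cladd (clmul (clscal a) (clclass x)) (clclass y)).
  by rewrite clmulE claddE !gE /= -scalerAl mul1r.
have gM u v : g (u * v) = g u * g v.
  case: (clclass_surj u) (clclass_surj v) => x -> [y ->].
  by rewrite -[_ * _ in LHS]/(clmul _ _) clmulE !gE.
have g1 : g 1 = 1 by rewrite -[1 in LHS]/(clscal 1) gE /= scale1r.
pose gl := GRing.isLinear.Build R clifford A *:%R g gZD.
pose gm := GRing.isMonoidMorphism.Build clifford A g (g1, gM).
pose G : {lrmorphism clifford -> A} := HB.pack g gl gm.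
exists G => [Z|h hE u]; first exact: gE.
case: (clclass_surj u) => x ->; rewrite [RHS]gE; elim: x => [Z|a|x IHx y IHy|x IHx y IHy] /=.
- exact: hE.
- by rewrite -[clclass _]/(clscal a) clscalE linearZ_LR rmorph1.
- by rewrite -claddE -[cladd _ _]/(clclass x + clclass y) raddfD /= IHx IHy.
- by rewrite -clmulE -[clmul _ _]/(clclass x * clclass y) rmorphM /= IHx IHy.
Qed.

End CliffordAlgebra.

Arguments clvec {R r s}.

(* Composition of endomorphisms is spelled out, as 'End(U) is not canonically  *)
(* a ring for an arbitrary vectType U.                                         *)
Record admissible_module (R : realType) (r s : nat) := AdmissibleModule {
  am_space :> vectType R;
  am_rep : {linear clifford R r s -> 'End(am_space)};
  am_form : {symmetric am_space};
  am_nonzero : (0 < \dim {:am_space})%N;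
  am_rep1 : am_rep 1 = \1%VF;
  am_repM : forall x y, am_rep (x * y) = (am_rep x \o am_rep y)%VF;
  am_nondegenerate : forall u, (forall v, am_form u v = 0) -> u = 0;
  am_skew : forall (Z : 'rV[R]_(r + s)) u v,
    am_form (am_rep (clvec Z) u) v = - am_form u (am_rep (clvec Z) v)
}.

Definition minimal_admissible (R : realType) (r s : nat)
    (M : admissible_module R r s) : Prop :=
  forall N : admissible_module R r s, (\dim {:M} <= \dim {:N})%N.

Record lie_algebra (R : realType) := LieAlgebra {
  lie_space :> lmodType R;
  lie_bracket : {bilinear lie_space -> lie_space -> lie_space};
  lie_alternating : forall x, lie_bracket x x = 0;
  lie_jacobi : forall x y z,
    lie_bracket x (lie_bracket y z) + lie_bracket y (lie_bracket z x)
    + lie_bracket z (lie_bracket x y) = 0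
}.
Arguments lie_bracket {R l}.

Definition lie_isomorphic (R : realType) (L L' : lie_algebra R) : Prop :=
  exists2 f : {linear L -> L'}, bijective f &
    forall x y, f (lie_bracket x y) = lie_bracket (f x) (f y).

Section PseudoHType.
Variables (R : realType) (r s : nat) (M : admissible_module R r s).
Local Notation V := 'rV[R]_(r + s).
Local Notation J Z := (am_rep M (clvec Z)).
Local Notation form := (@am_form R r s M).

(* Coordinates of the solution b of <J_Z u, v> = <Z, b>; see vbracketP.        *)
Definition vbracket (u v : M) : V :=
  \row_i (psign R i * form (J (delta_mx 0 i) u) v).

Lemma vbracketE Z u v : form (J Z u) v = pform Z (vbracket u v).
Proof.
rewrite {1}(row_sum_delta Z) linear_sum linear_sum sum_lfunE linear_sumlz /=.
rewrite pformE; apply: eq_bigr => i _.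
rewrite linearZ_LR linearZ_LR scale_lfunE linearZl_LR /= mxE.
by rewrite mulrCA [psign R i * (psign R i * _)]mulrA psignK mul1r.
Qed.

Lemma vbracketP u v (b : V) :
  (forall Z, form (J Z u) v = pform Z b) <-> b = vbracket u v.
Proof.
split=> [bP|-> Z]; last exact: vbracketE.
have E i (c : V) : pform (delta_mx 0 i) c = psign R i * c 0 i.
  rewrite pformE (bigD1 i) //= mxE !eqxx mul1r big1 ?addr0 // => j ji.
  by rewrite mxE (negPf ji) mul0r mulr0.
apply/rowP => i; have := bP (delta_mx 0 i); rewrite vbracketE !E.
by move/(congr1 ( *%R (psign R i))); rewrite !mulrA psignK !mul1r.
Qed.

Lemma vbracket_alt u : vbracket u u = 0.
Proof.
apply/esym/vbracketP => Z; rewrite pformE big1 => [|i _]; last first.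
  by rewrite mxE !mulr0.
have: form (J Z u) u = - form (J Z u) u.
  by rewrite {1}am_skew [form u _]hermC /= expr0 mul1r.
by move/eqP; rewrite -addr_eq0 -mulr2n mulrn_eq0 => /eqP.
Qed.

Definition pseudoH_bracket (x y : M * V) : M * V := (0, vbracket x.1 y.1).

Lemma pseudoH_bracket_linear :
  (forall y, linear_for *:%R (pseudoH_bracket^~ y)) *
  (forall x, linear_for *:%R (pseudoH_bracket x)).
Proof.
split=> z a x y; rewrite /pseudoH_bracket; congr (_, _) => /=;
  rewrite ?scaler0 ?addr0 //; apply/rowP => i; rewrite !mxE /=.
  by rewrite [fun_of_lfun _ _]linearP linearPl /=; ring.
by rewrite linearPr /=; ring.
Qed.

HB.instance Definition _ := bilinear_isBilinear.Build R _ _ _ _ _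
  pseudoH_bracket pseudoH_bracket_linear.

Lemma pseudoH_alternating x : pseudoH_bracket x x = 0.
Proof. by rewrite /pseudoH_bracket vbracket_alt. Qed.

Lemma pseudoH_jacobi x y z :
  pseudoH_bracket x (pseudoH_bracket y z)
  + pseudoH_bracket y (pseudoH_bracket z x)
  + pseudoH_bracket z (pseudoH_bracket x y) = 0.
Proof.
have B0 u : vbracket u 0 = 0.
  by apply/rowP => i; rewrite !mxE linear0r mulr0.
by rewrite /pseudoH_bracket /= !B0 !addr0.
Qed.

Definition pseudoH_algebra : lie_algebra R :=
  @LieAlgebra R (M * V)%type pseudoH_bracket
    pseudoH_alternating pseudoH_jacobi.

End PseudoHType.

(* Main.v *)
From HB Require Import structures.
Require Import Defs.
From mathcomp Require Import all_boot all_order all_algebra.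
From mathcomp Require Import boolp reals.
From mathcomp Require Import ring lra.

(** The two algebras are told apart by the maps [D] of the module that are skew
for the bracket, [[D x, y] + [x, D y] = 0]. This notion depends on the Lie
algebra alone: the module is its quotient by the center, and an isomorphism
induces one of these quotients.

Let [W] be the volume element, the product of the five generators. As five is
odd, [W] commutes with every [J_Z], and as it is skew for the scalar product
it is bracket-skew. Its square is [+1] for signature (2, 3) and [-1] for
signature (3, 2). An isomorphism thus moves the volume element of the (2, 3)
module to a bracket-skew involution [D] of the (3, 2) module [M]
(transport_involution), and it remains to see that there is none
(no_bracket_skew_involution).

The generators being numbered from 0, those of square [-1] first, the even
products of them commute with [D]. Among them [e = J_0 J_3] and
[f = J_1 J_4] are commuting involutions of [M], and since [J_0] anticommutes
with [e] and [J_1] with [f], their common fixed space [P] has dimension a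
quarter of [dim M]. Now [dim M <= 8], because an admissible module of that
dimension exists (admissible32), so that [dim P <= 2]. On [P] the symmetric
form [b(x, y) = <J_0 J_1 J_2 x, y>] is not zero, so some [x] in [P] has
[b(x, x) <> 0]. One computes [b(W x, W x) = b(x, x)] and [b(x, W x) = 0], so
[x] and [W x] span [P], and [b] is definite there. On the other hand
[b(D x, D x) = - b(x, D (D x)) = - b(x, x)]. Writing [D x = a x + c W x] gives
[(a^2 + c^2) b(x, x) = - b(x, x)], which is absurd over an ordered field. *)

Set Implicit Arguments.
Unset Strict Implicit.
Unset Printing Implicit Defensive.

Import Order.TTheory GRing.Theory Num.Theory.
Local Open Scope ring_scope.

(** * Products of generators acting on an admissible module *)

Section Blades.
Variables (R : realType) (r s : nat) (M : admissible_module R r s).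
Implicit Types (x y : M) (k : 'I_(r + s)) (t u : seq 'I_(r + s)).
Local Notation form := (@am_form R r s M).

Definition gen k x : M := am_rep M (clvec (delta_mx 0 k)) x.

Lemma gen_is_linear k : linear (gen k).
Proof. by move=> a x y; rewrite /gen linearP. Qed.

HB.instance Definition _ k :=
  GRing.isLinear.Build R M M *:%R (gen k) (gen_is_linear k).

Lemma pform_delta k l : pform (delta_mx 0 k) (delta_mx 0 l) =
  psign R k * (k == l)%:R :> R.
Proof.
rewrite pformE (bigD1 k) //= !mxE !eqxx mul1r big1 ?addr0 //= => j jk.
by rewrite mxE (negPf jk) andbF mul0r mulr0.
Qed.

Lemma am_rep_sqr (Z : 'rV[R]_(r + s)) x :
  am_rep M (clvec Z) (am_rep M (clvec Z) x) = - pform Z Z *: x.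
Proof.
rewrite -comp_lfunE -am_repM clvec_sqr linearZ_LR am_rep1 /=.
by rewrite scale_lfunE id_lfunE.
Qed.

Lemma gen_sqr k x : gen k (gen k x) = - psign R k *: x.
Proof. by rewrite /gen am_rep_sqr pform_delta eqxx mulr1. Qed.

Lemma genC k l x : k != l -> gen k (gen l x) = - gen l (gen k x).
Proof.
move=> kl; have := am_rep_sqr (delta_mx 0 k + delta_mx 0 l) x.
have pf : pform (delta_mx 0 k + delta_mx 0 l) (delta_mx 0 k + delta_mx 0 l)
   = psign R k + psign R l.
  transitivity (pform (delta_mx 0 k) (delta_mx 0 k) +
    pform (delta_mx 0 l) (delta_mx 0 l) + (pform (delta_mx 0 k) (delta_mx 0 l)
    + pform (delta_mx 0 l) (delta_mx 0 k)) : R); last first.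
    by rewrite !pform_delta !eqxx (negPf kl) eq_sym (negPf kl) !mulr0 !mulr1 !addr0.
  rewrite !pformE -!big_split /=; apply: eq_bigr => i _; rewrite !mxE; ring.
(* The square of the sum is the sum of the two squares; cancelling these leaves
   the cross terms. *)
rewrite pf !linearD /= !add_lfunE !linearD /= -!/(gen _ _) !gen_sqr.
rewrite opprD scalerDl => E.
apply/eqP; rewrite -addr_eq0; apply/eqP.
apply: (addrI (- psign R k *: x + - psign R l *: x)); rewrite addr0 -[RHS]E.
by rewrite [LHS](AC (2*2) (1*3*(4*2))%AC).
Qed.

(** The basis blades of the Clifford algebra, acting on the module. *)
Definition blade t x : M := foldr (fun k y => gen k y) x t.

Lemma blade_is_linear t : linear (blade t).
Proof.
by elim: t => // k t IH a x y; rewrite -[LHS]/(gen k (blade t _)) IH linearP.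
Qed.

HB.instance Definition _ t :=
  GRing.isLinear.Build R M M *:%R (blade t) (blade_is_linear t).

Lemma blade_cons k t x : blade (k :: t) x = gen k (blade t x).
Proof. by []. Qed.

Lemma blade_cat t u x : blade (t ++ u) x = blade t (blade u x).
Proof. by rewrite /blade foldr_cat. Qed.

(** Each factor other than [k] costs one change of sign. *)
Lemma gen_blade k t x :
  gen k (blade t x) = (-1) ^+ count (predC1 k) t *: blade t (gen k x).
Proof.
elim: t x => [|l t IH] x /=; first by rewrite scale1r.
case: (eqVneq l k) => [->|lk] /=; first by rewrite IH linearZ_LR.
by rewrite genC 1?eq_sym // IH linearZ_LR exprS mulN1r scaleNr.
Qed.

(** The exponent is kept as a computable count, so that for explicit index lists
its parity is settled by evaluation. *)
Lemma blade_comm t u x : blade t (blade u x) =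
  (-1) ^+ sumn [seq count (predC1 k) u | k <- t] *: blade u (blade t x).
Proof.
elim: t x => [|k t IH] x; first by rewrite scale1r.
by rewrite !blade_cons IH linearZ_LR /= gen_blade scalerA -exprD addnC.
Qed.

Lemma blade_comm_even t u x :
  ~~ odd (sumn [seq count (predC1 k) u | k <- t]) ->
  blade t (blade u x) = blade u (blade t x).
Proof. by move=> ev; rewrite blade_comm -signr_odd (negPf ev) scale1r. Qed.

Lemma blade_comm_odd t u x :
  odd (sumn [seq count (predC1 k) u | k <- t]) ->
  blade t (blade u x) = - blade u (blade t x).
Proof. by move=> od; rewrite blade_comm -signr_odd od scaleN1r. Qed.

Lemma count_predC1_uniq k t : uniq t ->
  count (predC1 k) t = (size t - (k \in t))%N.
Proof. by move=> ut; rewrite -(count_predC (pred1 k) t) count_uniq_mem // addKn. Qed.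

Lemma blade_sqr t x : uniq t -> blade t (blade t x) =
  ((-1) ^+ 'C(size t, 2) * \prod_(k <- t) - psign R k) *: x.
Proof.
elim: t => [|k t IH] /=; first by rewrite big_nil mulr1 scale1r.
case/andP=> kt ut; rewrite -!/(blade _ _) gen_blade count_predC1_uniq // (negPf kt).
rewrite subn0 gen_sqr linearZ_LR /= IH // !scalerA big_cons binS bin1 exprD.
congr (_ *: _); ring.
Qed.

(** Reversing the factors makes each pair of them cross once. *)
Lemma blade_rev t x :
  uniq t -> blade (rev t) x = (-1) ^+ 'C(size t, 2) *: blade t x.
Proof.
elim: t x => [|k t IH] x /=; first by rewrite scale1r.
case/andP=> kt ut; rewrite rev_cons -cats1 blade_cat /= IH //.
rewrite gen_blade count_predC1_uniq // (negPf kt) subn0 scalerA -exprD binS bin1.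
rewrite -addnA addnn -muln2 exprD exprM.
by rewrite sqrr_sign mulr1.
Qed.

Lemma gen_skew k x y : form (gen k x) y = - form x (gen k y).
Proof. exact: am_skew. Qed.

Lemma blade_adj_rev t x y :
  form (blade t x) y = (-1) ^+ size t * form x (blade (rev t) y).
Proof.
elim: t x y => [|k t IH] x y; first by rewrite mul1r.
rewrite blade_cons gen_skew IH rev_cons -cats1 blade_cat /=.
by rewrite exprS mulN1r mulNr.
Qed.

(** One sign per factor for skewness, one per pair for the reversal:
[n + C(n, 2) = C(n + 1, 2)]. *)
Lemma blade_adj t x y : uniq t ->
  form (blade t x) y = (-1) ^+ 'C((size t).+1, 2) * form x (blade t y).
Proof.
move=> ut; rewrite blade_adj_rev blade_rev // linearZr_LR /= mulrA -exprD.
by rewrite binS bin1 addnC.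
Qed.

(** The derivations of the Lie algebra that preserve the module and vanish on the
center. *)
Definition bracket_skew (D : M -> M) :=
  forall x y, vbracket (D x) y = - vbracket x (D y).

Lemma form_gen k x y : form (gen k x) y = psign R k * vbracket x y 0 k.
Proof. by rewrite mxE mulrA psignK mul1r. Qed.

Lemma form_inj x y : (forall z, form x z = form y z) -> x = y.
Proof.
move=> xy; apply/eqP; rewrite -subr_eq0; apply/eqP/am_nondegenerate => z.
by rewrite linearBl /= xy subrr.
Qed.

Lemma bracket_skew_gen D k x y :
  bracket_skew D -> form (gen k (D x)) y = - form (gen k x) (D y).
Proof. by move=> hD; rewrite !form_gen hD mxE mulrN. Qed.

(** Let [D'] be the adjoint of [D]. Skewness reads [J D = - D' J] for every
generator [J]; as [J] is invertible and skew, also [J D' = - D J]. So [D]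
becomes [D'] and then [D] again when it crosses two generators. The adjoint is
avoided by testing against vectors in the image of the first generator. *)
Lemma bracket_skew_gen2 D k l x :
  bracket_skew D -> D (gen k (gen l x)) = gen k (gen l (D x)).
Proof.
move=> hD; apply: form_inj => z.
have -> : z = gen k (- psign R k *: gen k z).
  by rewrite linearZ_LR /= gen_sqr scalerA mulrNN psignK scale1r.
move: (_ *: _) => {}z.
transitivity (form (gen k (gen k (gen l x))) (D z)).
  by rewrite -[RHS]opprK -bracket_skew_gen // gen_skew opprK.
rewrite gen_sqr linearZl_LR /= -[form (gen l x) _]opprK -bracket_skew_gen //.
rewrite -[RHS]opprK -gen_skew gen_sqr linearZl_LR /=.
by rewrite mulrN.
Qed.

Lemma bracket_skew_blade_even D t x :
  bracket_skew D -> ~~ odd (size t) -> D (blade t x) = blade t (D x).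
Proof.
move=> hD; have [n] := ubnP (size t); elim: n t => // n IH [|k [|l t]] //= tn.
rewrite negbK => ot; rewrite bracket_skew_gen2 // -!/(blade _ _) IH //.
exact: ltnW.
Qed.

Lemma bracket_skew_blade_odd D t x y :
  bracket_skew D -> odd (size t) ->
  form (blade t (D x)) y = - form (blade t x) (D y).
Proof.
case: t => [|k t] //= hD ot.
by rewrite -!/(blade _ _) -bracket_skew_blade_even // bracket_skew_gen.
Qed.

Definition volume x : M := blade (enum 'I_(r + s)) x.

(** The [C(r + s, 2)] crossings give one sign each, and so does each of the [r]
generators of square [-1]. *)
Lemma volume_sqr x : volume (volume x) = (-1) ^+ ('C(r + s, 2) + r) *: x.
Proof.
rewrite /volume blade_sqr ?enum_uniq // size_enum_ord big_enum /=.
rewrite big_split_ord /= exprD.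
under eq_bigr do rewrite psign_lshift.
under [X in _ * (_ * X)]eq_bigr do rewrite psign_rshift opprK.
by rewrite !prodr_const !card_ord expr1n mulr1.
Qed.

(** A generator crosses the [r + s - 1] other ones, an even number. *)
Lemma gen_volume k x : odd (r + s) -> gen k (volume x) = volume (gen k x).
Proof.
move=> on; rewrite /volume gen_blade count_predC1_uniq ?enum_uniq //.
rewrite mem_enum size_enum_ord inE -signr_odd oddB ?(leq_trans _ (ltn_ord k)) //.
by rewrite on scale1r.
Qed.

Lemma blade_volume t x : odd (r + s) -> blade t (volume x) = volume (blade t x).
Proof. by move=> on; elim: t => //= k t ->; rewrite gen_volume. Qed.

Lemma volume_adj x y :
  form (volume x) y = (-1) ^+ 'C((r + s).+1, 2) * form x (volume y).
Proof. by rewrite blade_adj ?enum_uniq // size_enum_ord. Qed.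

(** The volume element commutes with all [J_Z] and is skew for the form. *)
Lemma volume_bracket_skew :
  odd (r + s) -> odd 'C((r + s).+1, 2) -> bracket_skew volume.
Proof.
move=> on oC x y; apply/rowP => k; rewrite !mxE -!/(gen _ _).
by rewrite gen_volume // volume_adj -signr_odd oC expr1 mulN1r mulrN.
Qed.

End Blades.
Arguments blade {R r s M} t x : simpl never.

(** * Transport of bracket-skew maps along isomorphisms *)

Lemma vbracket0l (R : realType) (r s : nat) (M : admissible_module R r s)
  (u : M) : vbracket 0 u = 0.
Proof. by apply/rowP => i; rewrite !mxE linear0 linear0l mulr0. Qed.

(** If [u] is central then [J_Z u = 0] for all [Z] by non-degeneracy, and one
generator, which is invertible, is enough to conclude. *)
Lemma vbracket_radical (R : realType) (r s : nat) (M : admissible_module R r s)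
  (u : M) : (0 < r + s)%N -> (forall v, vbracket u v = 0) -> u = 0.
Proof.
move=> rs u0; pose k := Ordinal rs; have gu0 : gen k u = 0.
  by apply: form_inj => z; rewrite form_gen u0 mxE mulr0 linear0l.
by rewrite -[u]scale1r -(psignK R k) -scalerA -[X in _ *: X]opprK -scaleNr
  -gen_sqr gu0 linear0 oppr0 scaler0.
Qed.

Section ModulePart.
Variables (R : realType) (r s r' s' : nat).
Variables (M : admissible_module R r s) (N : admissible_module R r' s').
Variables (f : {linear pseudoH_algebra M -> pseudoH_algebra N}).
Hypothesis fM : forall x y, f (lie_bracket x y) = lie_bracket (f x) (f y).
Hypothesis f_bij : bijective f.
Hypothesis rs'_gt0 : (0 < r' + s')%N.

Definition vpart (x : M) : N := (f (x, 0)).1.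

(** [(0, z)] is central, and the center of the target is its second summand. *)
Lemma lie_iso_center z : (f (0, z)).1 = 0.
Proof.
have [g fK gK] := f_bij; apply: vbracket_radical => // v.
have := fM (0, z) (g (v, 0)); rewrite gK.
rewrite -[lie_bracket _ _ in LHS]/(pseudoH_bracket _ _) /pseudoH_bracket.
rewrite -[lie_bracket _ _ in RHS]/(pseudoH_bracket _ _) /pseudoH_bracket /=.
rewrite vbracket0l -[(0, 0)]/(0 : pseudoH_algebra M) linear0.
by case.
Qed.

Lemma vpartE p : (f p).1 = vpart p.1.
Proof.
case: p => x z; have -> : (x, z) = (x, 0) + (0, z) :> pseudoH_algebra M.
  by congr pair; rewrite /= ?addr0 ?add0r.
by rewrite linearD /= lie_iso_center // !addr0.
Qed.

Lemma vpart_bracket x y :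
  f (0, vbracket x y) = (0, vbracket (vpart x) (vpart y)).
Proof. exact: fM (x, 0) (y, 0). Qed.

End ModulePart.

(** The components between the two modules of an isomorphism and of its inverse
are mutually inverse and respect the brackets, so [E] can be conjugated by
them. *)
Lemma transport_involution (R : realType) (r s r' s' : nat)
    (M : admissible_module R r s) (N : admissible_module R r' s')
    (E : N -> N) :
  (0 < r + s)%N -> (0 < r' + s')%N ->
  lie_isomorphic (pseudoH_algebra M) (pseudoH_algebra N) ->
  bracket_skew E -> involutive E ->
  exists2 D : M -> M, bracket_skew D & involutive D.
Proof.
move=> rs rs' [f bf fM] Eskew EK; have [g fK gK] := bf.
have gD : linear g by exact: can2_linear fK gK.
pose gl := GRing.isLinear.Build R _ _ _ g gD.
pose G : {linear pseudoH_algebra N -> pseudoH_algebra M} := HB.pack g gl.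
have bG : bijective G by exists f.
have GM x y : G (lie_bracket x y) = lie_bracket (G x) (G y).
  by apply: (can_inj fK); rewrite fM /= !gK.
pose A := vpart f; pose B := vpart G.
have AB y : A (B y) = y by rewrite /A -(vpartE fM bf rs') /= gK.
have BA x : B (A x) = x by rewrite /B -(vpartE GM bG rs) /= fK.
exists (B \o E \o A) => [x y|x] /=; last by rewrite AB EK BA.
apply/eqP; rewrite -addr_eq0; apply/eqP.
suff: f (0, vbracket (B (E (A x))) y + vbracket x (B (E (A y)))) = 0.
  by rewrite -(linear0 f) => /(can_inj fK)[].
have -> : forall a b : 'rV[R]_(r + s),
    (0, a + b) = (0, a) + (0, b) :> pseudoH_algebra M.
  by move=> a b; congr pair; rewrite addr0.
rewrite linearD /= !vpart_bracket // -!/(A _) !AB Eskew.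
by congr pair; rewrite /= ?addr0 ?addNr.
Qed.

(** * Bracket-skew maps in signature (3, 2) *)

(** [g] exchanges the eigenspaces of [e] for the eigenvalues [1] and [-1], whose
direct sum is [U]. *)
Lemma dim_fixed_half (K : numFieldType) (vT : vectType K) (U : {vspace vT})
    (e g : {linear vT -> vT}) (c : K) :
  c != 0 -> involutive e -> (forall x, g (g x) = c *: x) ->
  (forall x, e (g x) = - g (e x)) ->
  {in U, forall x, e x \in U} -> {in U, forall x, g x \in U} ->
  (\dim (U :&: fixedSpace (linfun e))).*2 = \dim U.
Proof.
move=> c0 eK gg eg eU gU; set F := (U :&: _)%VS.
have FP x : (x \in F) = (x \in U) && (e x == x).
  rewrite memv_cap; congr (_ && _).
  by apply/fixedSpaceP/eqP; rewrite lfunE.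
have gi : injective g.
  by move=> x y /(congr1 g); rewrite !gg; apply: scalerI.
have dg : \dim (linfun g @: F) = \dim F.
  apply: limg_dim_eq; apply/eqP; rewrite -subv0; apply/subvP => x.
  rewrite memv_cap memv_ker lfunE /= memv0 => /andP[_].
  by rewrite -{1}(linear0 g) (inj_eq gi).
have FgF : (F :&: (linfun g @: F))%VS = 0%VS.
  apply/eqP; rewrite -subv0; apply/subvP => x.
  rewrite memv_cap memv0 => /andP[xF /memv_imgP[y yF xy]].
  move: xF yF; rewrite !FP => /andP[_ /eqP ex] /andP[_ /eqP ey].
  move: xy; rewrite lfunE /= => xy.
  have: e x = - x by rewrite {1}xy eg ey -xy.
  by rewrite ex => /eqP; rewrite -addr_eq0 -mulr2n -scaler_nat scaler_eq0 pnatr_eq0.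
rewrite -addnn -{2}dg -(dimv_disjoint_sum FgF); congr (\dim _).
apply/eqP; rewrite eqEsubv; apply/andP; split.
  apply/subvP => x /memv_addP[y yF [z /memv_imgP[w wF ->] ->]].
  move: yF wF; rewrite !FP lfunE => /andP[yU _] /andP[wU _].
  by rewrite memvD // gU.
apply/subvP => x xU.
have e2 y : e (e y) = y by exact: eK.
(* The component of [x] in the [-1]-eigenspace, [(x - e x) / 2], is the image
   under [g] of [g (x - e x) / (2 c)], as [g] has square [c]. *)
have -> : x = 2^-1 *: (x + e x) + linfun g ((2 * c)^-1 *: g (x - e x)).
  rewrite lfunE /= linearZ_LR /= gg scalerA invfM -mulrA mulVf // mulr1.
  rewrite -scalerDr addrACA subrr addr0 -mulr2n -scaler_nat scalerA.
  by rewrite mulVf ?scale1r // pnatr_eq0.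
apply: memv_add; last apply: memv_img; rewrite FP !linearZ_LR /=.
  by rewrite memvZ ?memvD ?eU //= linearD e2 addrC.
by rewrite memvZ ?gU ?memvB ?eU //= eg linearB /= e2 -linearN opprB.
Qed.

Section Signature32.
Variables (R : realType) (M : admissible_module R 3 2).
Local Notation form := (@am_form R 3 2 M).
Local Notation "''i_' k" := (@Ordinal (3 + 2) k isT) (at level 8, k at level 2).

(* Numbering from 0: the generators 0, 1, 2 have square [-1], and 3, 4 have
   square [1]. *)
Local Notation e := (@blade R 3 2 M [:: 'i_0; 'i_3]).
Local Notation f := (@blade R 3 2 M [:: 'i_1; 'i_4]).
Local Notation h := (@blade R 3 2 M [:: 'i_0; 'i_1; 'i_2]).
Local Notation b x y := (form (@blade R 3 2 M [:: 'i_0; 'i_1; 'i_2] x) y).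

Lemma blade03K : involutive e.
Proof.
move=> x; rewrite blade_sqr //= !big_cons big_nil /psign /=.
by rewrite opprK !mulr1 mulrNN mul1r scale1r.
Qed.

Lemma blade14K : involutive f.
Proof.
move=> x; rewrite blade_sqr //= !big_cons big_nil /psign /=.
by rewrite opprK !mulr1 mulrNN mul1r scale1r.
Qed.

Lemma blade012K : involutive h.
Proof.
move=> x; rewrite blade_sqr // !big_cons big_nil /psign /=.
by rewrite -signr_odd expr1 !mulN1r !opprK scale1r.
Qed.

Definition common_fixed : {vspace M} :=
  (fullv :&: fixedSpace (linfun e) :&: fixedSpace (linfun f))%VS.

Lemma common_fixedP x : reflect (e x = x /\ f x = x) (x \in common_fixed).
Proof.
rewrite /common_fixed !memv_cap memvf /=; apply: (iffP andP).
  by case=> /fixedSpaceP + /fixedSpaceP; rewrite !lfunE.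
by case=> ex fx; split; apply/fixedSpaceP; rewrite lfunE.
Qed.

Lemma dim_common_fixed : (\dim common_fixed * 4)%N = \dim {:M}.
Proof.
have sq_neq0 (k : 'I_(3 + 2)) : - psign R k != 0.
  by rewrite oppr_eq0 /psign; case: ifP => _; rewrite ?oppr_eq0 oner_eq0.
have anti_e x : e (gen 'i_0 x) = - gen 'i_0 (e x).
  exact: (@blade_comm_odd R 3 2 M [:: 'i_0; 'i_3] [:: 'i_0] x isT).
have anti_f x : f (gen 'i_1 x) = - gen 'i_1 (f x).
  exact: (@blade_comm_odd R 3 2 M [:: 'i_1; 'i_4] [:: 'i_1] x isT).
pose F := (fullv :&: fixedSpace (linfun e))%VS.
have stable t :
    ~~ odd (sumn [seq count (predC1 k) t | k <- [:: 'i_0; 'i_3]]) ->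
    {in F, forall x, blade t x \in F}.
  move=> ev x; rewrite !memv_cap !memvf /= => /fixedSpaceP.
  rewrite lfunE /= => ex; apply/fixedSpaceP; rewrite lfunE.
  by apply: etrans (blade_comm_even _ ev) _; exact: (congr1 (blade t) ex).
have half_e := dim_fixed_half (sq_neq0 'i_0) blade03K (gen_sqr _) anti_e
  (fun _ _ => memvf _) (fun x (_ : x \in fullv) => memvf _).
have half_f := dim_fixed_half (sq_neq0 'i_1) blade14K (gen_sqr _) anti_f
  (stable [:: 'i_1; 'i_4] isT) (stable [:: 'i_1] isT).
by rewrite -half_e -half_f -!muln2 -mulnA.
Qed.

Lemma form012Dl x y z : b (x + y) z = b x z + b y z.
Proof. by rewrite linearD linearDl. Qed.

Lemma form012Zl a x z : b (a *: x) z = a * b x z.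
Proof. by rewrite linearZ_LR linearZl_LR. Qed.

Lemma form012C x y : b x y = b y x.
Proof. by rewrite blade_adj //= -signr_odd mul1r hermC expr0 mul1r. Qed.

(** A non-zero [x0] in the common fixed space pairs with some [w] of [M]. The
blade 012 anticommutes with [e] and [f], which are skew, so for the form [b]
they may be moved onto [x0], where they act trivially: hence [x0] pairs also
with the projection of [w] to the common fixed space. Polarization concludes. *)
Lemma exists_anisotropic : exists2 x, x \in common_fixed & b x x != 0.
Proof.
have P0 : common_fixed != 0%VS.
  rewrite -dimv_eq0; have := am_nonzero M.
  by rewrite -dim_common_fixed muln_gt0 andbT lt0n.
have x0P := memv_pick common_fixed; set x0 := vpick common_fixed in x0P.
have /common_fixedP[ex fx] := x0P.
have [w bw] : exists w, b x0 w != 0.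
  apply: contrapT => nw; have hx0 : h x0 = 0.
    apply: am_nondegenerate => v; apply: contrapT => /eqP hv.
    by apply: nw; exists v.
  move: P0; rewrite -vpick0 -/x0 => /eqP; apply.
  by rewrite -[x0]blade012K hx0 linear0.
(* Four times the projection of [w] to the common fixed space. *)
pose y := (w + f w) + e (w + f w).
have fy : f y = y.
  rewrite /y linearD /= [f (e _)]blade_comm_even // linearD /= blade14K.
  by rewrite [f w + w]addrC.
have ey : e y = y by rewrite /y linearD /= blade03K addrC.
have yP : y \in common_fixed by apply/common_fixedP.
have adje v : form (h x0) (e v) = b x0 v.
  have := blade_adj (h x0) v (isT : uniq [:: 'i_0; 'i_3]).
  rewrite blade_comm_odd //= -signr_odd /= expr1 mulN1r linearNl /= ex.
  by move/oppr_inj.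
have adjf v : form (h x0) (f v) = b x0 v.
  have := blade_adj (h x0) v (isT : uniq [:: 'i_1; 'i_4]).
  rewrite blade_comm_odd //= -signr_odd /= expr1 mulN1r linearNl /= fx.
  by move/oppr_inj.
have b0y : b x0 y != 0.
  rewrite /y !linearDr /= adje !linearDr /= adjf.
  have -> : b x0 w + b x0 w + (b x0 w + b x0 w) = 4 * b x0 w by ring.
  by rewrite mulf_neq0 // pnatr_eq0.
clearbody y.
have [b00|] := eqVneq (b x0 x0) 0; last by exists x0.
have [byy|] := eqVneq (b y y) 0; last by exists y.
exists (x0 + y); first exact: memvD.
rewrite form012Dl !linearDr /= b00 byy add0r addr0 [b y x0]form012C.
by rewrite -mulr2n mulrn_eq0.
Qed.

(** The form [b] is definite on the plane spanned by [x] and its image under the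
volume element [o], while [D] is an anti-isometry of [b] on that plane. *)
Lemma no_bracket_skew_involution (D : M -> M) : (\dim {:M} <= 8)%N ->
  bracket_skew D -> involutive D -> False.
Proof.
move=> dimM hD DK; have [x xP bx] := exists_anisotropic.
have /common_fixedP[ex fx] := xP.
pose o := @volume R 3 2 M.
have oo y : o (o y) = - y by rewrite /o volume_sqr -signr_odd scaleN1r.
have oadj y z : form (o y) z = - form y (o z).
  by rewrite /o volume_adj -signr_odd mulN1r.
have oP : o x \in common_fixed.
  by apply/common_fixedP; rewrite !blade_volume // ex fx.
have box : b (o x) x = 0.
  have: b (o x) x = - b (o x) x.
    by rewrite {1}blade_volume // oadj form012C.
  by move/eqP; rewrite -addr_eq0 -mulr2n mulrn_eq0 => /eqP.
have boo : b (o x) (o x) = b x x by rewrite blade_volume // oadj oo linearNr opprK.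
(* [D] commutes with [e] and [f], which are even. *)
have DP : D x \in common_fixed.
  by apply/common_fixedP; split; rewrite -(bracket_skew_blade_even _ hD) ?ex ?fx.
have free_xo : free [:: x; o x].
  rewrite free_cons seq1_free span_seq1; apply/andP; split.
    apply/negP => /vlineP[a xa]; move: bx.
    by rewrite {1}xa form012Zl box mulr0 eqxx.
  by apply: contraNneq bx => o0; rewrite -boo o0 linear0.
have PE : common_fixed = <<[:: x; o x]>>%VS.
  apply/esym/eqP; rewrite eqEdim; apply/andP; split.
    by apply/span_subvP => y; rewrite !inE => /orP[]/eqP->.
  by have /eqP-> := free_xo; rewrite /= -(@leq_pmul2r 4) // dim_common_fixed.
move: DP; rewrite PE span_cons span_seq1.
case/memv_addP => _ /vlineP[a ->] [_ /vlineP[c ->] Dx].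
have bDD : b (D x) (D x) = - b x x.
  by rewrite -[LHS]opprK -(bracket_skew_blade_odd _ _ hD) ?DK.
have : b (D x) (D x) = (a ^+ 2 + c ^+ 2) * b x x.
  rewrite Dx form012Dl !form012Zl ![b _ (_ + _)]form012C !form012Dl !form012Zl.
  rewrite boo [b x (o x)]form012C box.
  by ring.
rewrite bDD => /eqP; rewrite -subr_eq0 -mulN1r -mulrBl mulf_eq0 (negPf bx) orbF.
by apply/negP; have := sqr_ge0 a; have := sqr_ge0 c; lra.
Qed.

End Signature32.

(** * Admissible modules given by matrices *)

Section MatrixForm.
Variables (R : realType) (d : nat) (B : 'M[R]_d).
Hypothesis B_sym : B^T = B.

(** The symmetry proof is an argument so that the form carries its structure of
symmetric bilinear form. *)
Definition mxform of B^T = B := fun u v : 'cV[R]_d => (u^T *m B *m v) 0 0.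
Local Notation q := (mxform B_sym).

Lemma mxform_bilinear :
  (forall v, linear_for *%R (q^~ v)) * (forall u, linear_for *%R (q u)).
Proof.
split=> v a x y; rewrite /mxform.
  by rewrite linearP !mulmxDl -!scalemxAl !mxE.
by rewrite mulmxDr -scalemxAr !mxE.
Qed.

HB.instance Definition _ := bilinear_isBilinear.Build R _ _ _
  (GRing.Scale.Law.clone _ _ ( *%R) _)
  (GRing.Scale.Law.clone _ _ (idfun \; *%R ) _)
  q mxform_bilinear.

Lemma mxform_sym u v : q u v = (-1) ^+ false * idfun (q v u).
Proof.
by rewrite mul1r /mxform /= -[u^T *m B *m v]trmxK mxE !trmx_mul trmxK B_sym mulmxA.
Qed.

HB.instance Definition _ := isHermitianSesquilinear.Build R _ _ _ q mxform_sym.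

End MatrixForm.

(** The universal property turns [J] into a representation by matrices, which
act on column vectors by left multiplication. *)
Lemma matrix_admissible (R : realType) (r s d : nat)
    (J : {linear 'rV[R]_(r + s) -> 'M[R]_d.+1}) (B : 'M[R]_d.+1) :
  (forall Z, J Z * J Z = - pform Z Z *: 1) ->
  B^T = B -> B \in unitmx ->
  (forall Z, (J Z)^T *m B = - (B *m J Z)) ->
  exists N : admissible_module R r s, \dim {:N} = d.+1.
Proof.
move=> Jsq BT Bu JB; have [g gJ _] := clifford_universal Jsq.
pose rep (x : clifford R r s) : 'End('cV[R]_d.+1) := linfun (mulmx (g x)).
have repE x u : rep x u = g x *m u by rewrite lfunE.
have rep_lin : linear rep.
  move=> a x y; apply/lfunP => u; rewrite add_lfunE scale_lfunE !repE.
  by rewrite linearP /= mulmxDl scalemxAl.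
pose repl := GRing.isLinear.Build R _ _ _ rep rep_lin.
pose Rep : {linear clifford R r s -> 'End('cV[R]_d.+1)} := HB.pack rep repl.
have dimd : \dim {: 'cV[R]_d.+1} = d.+1 by rewrite dimvf /dim /= muln1.
unshelve eexists (@AdmissibleModule R r s 'cV[R]_d.+1 Rep (mxform BT) _ _ _ _ _).
- by rewrite dimd.
- by apply/lfunP => u; rewrite repE rmorph1 mul1mx id_lfunE.
- by move=> x y; apply/lfunP => u; rewrite comp_lfunE !repE rmorphM -mulmxA.
- move=> u u0; apply: trmx_inj; rewrite trmx0.
  rewrite -[LHS](mulmxK Bu); apply/eqP; suff -> : u^T *m B = 0 by rewrite mul0mx.
  apply/rowP => i; have := u0 (delta_mx i 0).
  by rewrite /= /mxform -colE !mxE.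
- move=> Z u v; rewrite /= /mxform !repE gJ trmx_mul -[_ *m B]mulmxA JB.
  by rewrite mulmxN mulNmx mxE !mulmxA.
exact: dimd.
Qed.

(** * An admissible module of dimension 8 in signature (3, 2) *)

Section Model32.
Variable R : realType.

(** Entries are 1 x 1 blocks, so that block rules give all the computations. *)
Definition mx2 (a b c d : R) : 'M[R]_2 :=
  block_mx a%:M b%:M c%:M d%:M : 'M_(1 + 1).

Lemma mx2_mul a b c d a' b' c' d' : mx2 a b c d *m mx2 a' b' c' d' =
  mx2 (a * a' + b * c') (a * b' + b * d') (c * a' + d * c') (c * b' + d * d').
Proof.
rewrite [LHS](@mulmx_block _ 1 1 1 1 1 1) -!scalar_mxM.
by rewrite -!raddfD.
Qed.

Lemma mx2_tr a b c d : (mx2 a b c d)^T = mx2 a c b d.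
Proof. by rewrite /mx2 [LHS](@tr_block_mx _ 1 1 1 1) !tr_scalar_mx. Qed.

Lemma mx2_opp a b c d : - mx2 a b c d = mx2 (- a) (- b) (- c) (- d).
Proof. by rewrite /mx2 [LHS](@opp_block_mx _ 1 1 1 1) -!raddfN. Qed.

Lemma mx2_add a b c d a' b' c' d' : mx2 a b c d + mx2 a' b' c' d' =
  mx2 (a + a') (b + b') (c + c') (d + d').
Proof. by rewrite /mx2 [LHS](@add_block_mx _ 1 1 1 1) -!raddfD. Qed.

Lemma mx2_scale k a b c d : k *: mx2 a b c d = mx2 (k * a) (k * b) (k * c) (k * d).
Proof. by rewrite /mx2 [LHS](@scale_block_mx _ 1 1 1 1) !scale_scalar_mx. Qed.

Lemma mx2_scalar a : a%:M = mx2 a 0 0 a.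
Proof. by rewrite -[LHS]/(a%:M : 'M_(1 + 1)) scalar_mx_block /mx2 !raddf0. Qed.

Local Notation "''i_' k" := (@Ordinal (3 + 2) k isT) (at level 8, k at level 2).
Implicit Types Z W : 'rV[R]_(3 + 2).

(** The determinant, a quadratic form of signature (2, 2) on 2 x 2 matrices, gives
four of the coordinates: [qpart Z] has determinant [Z1^2 + Z2^2 - Z3^2 - Z4^2],
and [qconj Z] is its adjugate. *)
Definition qpart Z : 'M[R]_2 :=
  mx2 (Z 0 'i_1 + Z 0 'i_3) (Z 0 'i_2 + Z 0 'i_4)
      (Z 0 'i_4 - Z 0 'i_2) (Z 0 'i_1 - Z 0 'i_3).
Definition qconj Z : 'M[R]_2 :=
  mx2 (Z 0 'i_1 - Z 0 'i_3) (- (Z 0 'i_2 + Z 0 'i_4))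
      (Z 0 'i_2 - Z 0 'i_4) (Z 0 'i_1 + Z 0 'i_3).
Definition omega : 'M[R]_2 := mx2 0 1 (-1) 0.

(** As a matrix times its adjugate is its determinant, [gamma Z] has square
[<Z, Z>]. It is self-adjoint for the symplectic form [cform]. *)
Definition gamma Z : 'M[R]_(2 + 2) :=
  block_mx (Z 0 'i_0)%:M (qpart Z) (qconj Z) (- (Z 0 'i_0)%:M).
Definition cform : 'M[R]_(2 + 2) := block_mx omega 0 0 omega.

(** [J_Z] is [gamma Z] times the complex structure of [R^4 (x) C], which makes its
square [- <Z, Z>]; the scalar product is [cform] times the same complex
structure, symmetric as a tensor product of two skew factors. *)
Definition model_J Z : 'M[R]_8 :=
  block_mx 0 (- gamma Z) (gamma Z) 0 : 'M_((2 + 2) + (2 + 2)).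
Definition model_form : 'M[R]_8 :=
  block_mx 0 (- cform) cform 0 : 'M_((2 + 2) + (2 + 2)).

Lemma pform32 Z : pform Z Z =
  Z 0 'i_0 ^+ 2 + Z 0 'i_1 ^+ 2 + Z 0 'i_2 ^+ 2 - Z 0 'i_3 ^+ 2 - Z 0 'i_4 ^+ 2.
Proof.
rewrite pformE /psign !big_ord_recl big_ord0 /= !mul1r !mulN1r addr0.
rewrite -!expr2 !addrA.
by do !congr (_ + _); congr (- _ ^+ _) || congr (_ ^+ _); congr (Z _ _);
  apply: val_inj.
Qed.

Lemma gamma_sqr Z : gamma Z *m gamma Z = (pform Z Z)%:M.
Proof.
have qq : qpart Z *m qconj Z = (pform Z Z - Z 0 'i_0 ^+ 2)%:M.
  by rewrite mx2_mul mx2_scalar pform32; congr mx2; ring.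
have qq' : qconj Z *m qpart Z = (pform Z Z - Z 0 'i_0 ^+ 2)%:M.
  by rewrite mx2_mul mx2_scalar pform32; congr mx2; ring.
rewrite mulmx_block qq qq' !mulNmx !mulmxN opprK -!scalar_mxM -!raddfD /=.
rewrite mul_scalar_mx mul_mx_scalar subrr mul_scalar_mx mul_mx_scalar subrr.
by rewrite scalar_mx_block -expr2 subrKC subrK.
Qed.

Lemma gamma_linear : linear gamma.
Proof.
move=> a Z W; rewrite /gamma scale_block_mx add_block_mx; congr block_mx.
- by rewrite !mxE raddfD /= scale_scalar_mx.
- by rewrite /qpart mx2_scale mx2_add !mxE; congr mx2; ring.
- by rewrite /qconj mx2_scale mx2_add !mxE; congr mx2; ring.
by rewrite !mxE raddfD /= scalerN scale_scalar_mx opprD.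
Qed.

Lemma gamma_cform Z : (gamma Z)^T *m cform = cform *m gamma Z.
Proof.
rewrite /gamma tr_block_mx !mulmx_block !(mulmx0, mul0mx, addr0, add0r).
rewrite linearN /= !tr_scalar_mx mulmxN mulNmx mul_scalar_mx mul_mx_scalar.
by congr block_mx; rewrite /qpart /qconj mx2_tr !mx2_mul; congr mx2; ring.
Qed.

Lemma omega_sqr : omega *m omega = - 1%:M.
Proof. by rewrite mx2_mul mx2_scalar mx2_opp; congr mx2; ring. Qed.

Lemma cform_sqr : cform *m cform = - 1%:M.
Proof.
rewrite mulmx_block !(mulmx0, mul0mx, addr0, add0r) !omega_sqr.
by rewrite scalar_mx_block opp_block_mx !oppr0.
Qed.

Lemma cform_tr : cform^T = - cform.
Proof.
rewrite tr_block_mx opp_block_mx !trmx0 !oppr0.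
by congr block_mx; rewrite mx2_tr mx2_opp !oppr0 opprK.
Qed.

Lemma model_J_linear : linear model_J.
Proof.
move=> a Z W; rewrite /model_J gamma_linear.
rewrite [in RHS](scale_block_mx a _ _ _ _ : _ *: (_ : 'M_((2 + 2) + (2 + 2))) = _).
rewrite [RHS](@add_block_mx _ 4 4 4 4) !scaler0 !addr0.
by rewrite scalerN opprD.
Qed.

HB.instance Definition _ := GRing.isLinear.Build R _ _ _ model_J model_J_linear.

Lemma model_J_sqr Z : model_J Z * model_J Z = - pform Z Z *: 1.
Proof.
rewrite -[LHS]/(_ *m _) [LHS](@mulmx_block _ 4 4 4 4 4 4).
rewrite !(mulmx0, mul0mx, addr0, add0r) mulNmx mulmxN gamma_sqr.
rewrite -[1]/(1%:M : 'M_((2 + 2) + (2 + 2))) scale_scalar_mx mulr1.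
by rewrite (@scalar_mx_block _ 4 4) raddfN.
Qed.

Lemma model_form_sym : model_form^T = model_form.
Proof.
by rewrite [LHS](@tr_block_mx _ 4 4 4 4) !trmx0 linearN /= cform_tr opprK.
Qed.

Lemma model_form_unit : model_form \in unitmx.
Proof.
suff BB : model_form *m model_form = 1%:M by have [] := mulmx1_unit BB.
rewrite [LHS](@mulmx_block _ 4 4 4 4 4 4) !(mulmx0, mul0mx, addr0, add0r).
rewrite mulNmx mulmxN cform_sqr opprK.
by rewrite [RHS](@scalar_mx_block _ 4 4).
Qed.

Lemma model_J_skew Z : (model_J Z)^T *m model_form = - (model_form *m model_J Z).
Proof.
rewrite [(model_J Z)^T](@tr_block_mx _ 4 4 4 4) !trmx0 linearN /=.
rewrite [LHS](@mulmx_block _ 4 4 4 4 4 4).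
rewrite [_ *m model_J Z](@mulmx_block _ 4 4 4 4 4 4).
rewrite [RHS](@opp_block_mx _ 4 4 4 4).
rewrite !(mulmx0, mul0mx, addr0, add0r, oppr0) !mulNmx !mulmxN !opprK.
by rewrite gamma_cform.
Qed.

Lemma admissible32 : exists N : admissible_module R 3 2, \dim {:N} = 8%N.
Proof.
exact: (matrix_admissible model_J_sqr model_form_sym model_form_unit model_J_skew).
Qed.

End Model32.

(** * Non-isomorphism *)

Theorem theorem6p4 (R : realType)
  (M : admissible_module R 3 2) (hM : minimal_admissible M)
  (N : admissible_module R 2 3) (hN : minimal_admissible N) :
  ~ lie_isomorphic (pseudoH_algebra M) (pseudoH_algebra N).
Proof.
move=> iso.
have dimM : (\dim {:M} <= 8)%N by have [A <-] := admissible32 R; exact: hM.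
have vol_invol : involutive (@volume R 2 3 N).
  by move=> x; rewrite volume_sqr -signr_odd scale1r.
have vol_skew : bracket_skew (@volume R 2 3 N) by exact: volume_bracket_skew.
have [D Dskew DK] :=
  transport_involution (isT : (0 < 3 + 2)%N) (isT : (0 < 2 + 3)%N)
    iso vol_skew vol_invol.
exact: no_bracket_skew_involution dimM Dskew DK.
Qed.
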